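(* Let $\alpha$ be an algebraic number all of whose conjugates have modulus $1$, and suppose there is a finite set $S\subset\mathbb{C}$ with $\mathbb{Z}[\alpha]=S[\alpha]$ and that the minimal cardinality of such a set equals $|M_\alpha(0)|$. Then every finite set $S\subset\mathbb{C}$ with $\mathbb{Z}[\alpha]=S[\alpha]$ and $\operatorname{Card}(S)=|M_\alpha(0)|$ satisfies $S\not\subseteq\mathbb{Z}$.
   Context: For $S\subset\mathbb{C}$ and $\alpha\in\mathbb{C}$, $S[\alpha]:=\{\sum_{j=0}^n f_j\alpha^j : n\in\mathbb{N},\ (f_0,\ldots,f_n)\in S^{n+1}\}$. For an algebraic number $\alpha$, $M_\alpha\in\mathbb{Z}[x]$ is its primitive minimal polynomial over $\mathbb{Q}$ (integer coefficients with gcd $1$); conjugates are over $\mathbb{Q}$ and include $\alpha$. *)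

(* Defs.v *)
From HB Require Import structures.
From mathcomp Require Export all_boot all_order all_algebra.
From mathcomp Require Export finmap complex.
From mathcomp Require Export mathcomp_extra boolp classical_sets reals.

Set Implicit Arguments.
Unset Strict Implicit.
Unset Printing Implicit Defensive.

Import Order.TTheory GRing.Theory Num.Theory.

Local Open Scope classical_set_scope.
Local Open Scope ring_scope.

Section Definitions.
Variable R : realType.
Local Notation C := R[i].

(* S[alpha]; every expansion has at least one digit (n = 0 is allowed), so
   0 belongs to S[alpha] only if it has an expansion with digits in S. *)
Definition expansions (S : set C) (alpha : C) : set C :=
  [set z | exists n : nat, exists f : 'I_n.+1 -> C,
     (forall j, S (f j)) /\ z = \sum_(j < n.+1) f j * alpha ^+ j].

Definition Zset : set C := range (fun m : int => m%:~R).

(* zcontents M is the gcd of the coefficients of M up to sign, so the sign of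
   the primitive minimal polynomial is left free. *)
Definition primitive_minpoly (M : {poly int}) (alpha : C) : Prop :=
  [/\ `|zcontents M|%N = 1%N,
      root (map_poly intr M) alpha &
      forall q : {poly rat}, q != 0 -> root (map_poly ratr q) alpha ->
        (size M <= size q)%N].

Definition conjugate (alpha beta : C) : Prop :=
  exists2 M : {poly int},
    primitive_minpoly M alpha & root (map_poly intr M) beta.

Definition digit_set (alpha : C) (S : {fset C}) : Prop :=
  expansions Zset alpha = expansions [set` S] alpha.

Definition min_digit_card (alpha : C) (m : nat) : Prop :=
  (exists2 S : {fset C}, digit_set alpha S & #|` S|%fset = m) /\
  (forall S : {fset C}, digit_set alpha S -> (m <= #|` S|%fset)%N).

End Definitions.

Arguments Zset {R}.

(* Main.v *)
(** Suppose [S] consists of integers. Since Z[alpha] / alpha Z[alpha] is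
    Z / M(0) and [S] has |M(0)| elements meeting every class, each z in Z[alpha]
    can be written z = s + alpha * T z for exactly one s in [S] (with T z in
    Z[alpha]), and z has an expansion iff the T-orbit of z reaches 0 after at
    least one step; in particular 0 is periodic. Let phi z be minus the complex
    conjugate of alpha * z. As alpha is unimodular and s is real,
    phi (T z) = s + alpha * phi z: the involution phi reverses the steps of T.
    Hence T maps L = {z in Z[alpha] | phi z in Z[alpha]} into itself, and it is
    injective there because s is also the digit of phi (T z). All of L being
    absorbed by the cycle of 0, injectivity forces L to be that finite cycle,
    although L contains every integer multiple of M(0) / alpha. *)

Require Import Defs.
From mathcomp Require Import ring.

Set Implicit Arguments.
Unset Strict Implicit.
Unset Printing Implicit Defensive.

Local Open Scope classical_set_scope.
Local Open Scope ring_scope.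

Import Order.TTheory GRing.Theory Num.Theory.

Lemma iter_inj_in (X : Type) (T : X -> X) (P : X -> Prop) :
  (forall x, P x -> P (T x)) ->
  (forall x y, P x -> P y -> T x = T y -> x = y) ->
  forall n x y, P x -> P y -> iter n T x = iter n T y -> x = y.
Proof.
move=> stabP injT; elim=> [//|n IHn] x y Px Py.
by rewrite !iterSr => /IHn eqT; apply: injT => //; apply: eqT; apply: stabP.
Qed.

(** Since [x0] is itself absorbed, its orbit is a cycle. Going round that cycle gives a point with
    the same iterated image as [x], and injectivity of the iterates identifies the two. *)
Lemma finite_of_injective_absorbed (X : eqType) (T : X -> X) (P : X -> Prop)
    (x0 : X) :
  (forall x, P x -> P (T x)) ->
  (forall x y, P x -> P y -> T x = T y -> x = y) ->
  P x0 ->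
  (forall x, P x -> exists n, iter n.+1 T x = x0) ->
  exists s : seq X, forall x, P x -> x \in s.
Proof.
move=> stabP injT Px0 absorb; have [p Tp] := absorb _ Px0.
have stab_iter n x : P x -> P (iter n T x) by elim: n => //= n IHn /IHn/stabP.
have iter_p k : iter (k * p.+1) T x0 = x0.
  by elim: k => [//|k IHk]; rewrite mulSn iterD IHk.
exists (traject T x0 p.+1) => x Px; have [n Tn] := absorb _ Px.
(* This makes [n.+1 + j] a multiple of the period [p.+1], so [n.+1] further steps take [iter j T x0]
   back to [x0]. *)
pose j := (n.+1 * p.+1 - n.+1)%N.
have -> : x = iter j T x0.
  apply: (@iter_inj_in _ T P stabP injT n.+1) => //; first exact: stab_iter.
  by rewrite Tn -iterD /j subnKC ?iter_p// leq_pmulr.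
rewrite (divn_eq j p.+1) addnC iterD iter_p.
by apply/trajectP; exists (j %% p.+1)%N; rewrite ?ltn_mod.
Qed.

Section IntegerAdjunction.
Variables (R : realType) (alpha : R[i]).

Definition int_adjoin : set R[i] :=
  [set z | exists p : {poly int}, z = (map_poly intr p).[alpha]].

Lemma int_adjoin_int (m : int) : int_adjoin m%:~R.
Proof. by exists m%:P; rewrite map_polyC hornerC. Qed.

Lemma int_adjoin0 : int_adjoin 0.
Proof. exact: (int_adjoin_int 0). Qed.

Lemma int_adjoinD x y : int_adjoin x -> int_adjoin y -> int_adjoin (x + y).
Proof. by move=> [p ->] [q ->]; exists (p + q); rewrite rmorphD hornerD. Qed.

Lemma int_adjoinN x : int_adjoin x -> int_adjoin (- x).
Proof. by move=> [p ->]; exists (- p); rewrite rmorphN hornerN. Qed.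

Lemma int_adjoinB x y : int_adjoin x -> int_adjoin y -> int_adjoin (x - y).
Proof. by move=> Ax Ay; apply: int_adjoinD => //; apply: int_adjoinN. Qed.

Lemma int_adjoinM x y : int_adjoin x -> int_adjoin y -> int_adjoin (x * y).
Proof. by move=> [p ->] [q ->]; exists (p * q); rewrite rmorphM hornerM. Qed.

Lemma int_adjoin_gen : int_adjoin alpha.
Proof. by exists 'X; rewrite map_polyX hornerX. Qed.

Lemma int_adjoinMX x : int_adjoin x -> int_adjoin (alpha * x).
Proof. by move=> Ax; apply: int_adjoinM => //; apply: int_adjoin_gen. Qed.

Lemma int_adjoin_sum n (f : 'I_n -> R[i]) :
  (forall j, Zset (f j)) -> int_adjoin (\sum_(j < n) f j * alpha ^+ j).
Proof.
move=> Zf; apply: (big_ind int_adjoin int_adjoin0 int_adjoinD) => j _.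
have [m _ <-] := Zf j; apply: int_adjoinM; first exact: int_adjoin_int.
by exists 'X^j; rewrite map_polyXn hornerXn.
Qed.

Lemma expansions_Zset : expansions Zset alpha = int_adjoin.
Proof.
apply/seteqP; split=> z /= [].
  by move=> n [f [Zf ->]]; apply: int_adjoin_sum.
(* One zero coefficient is added at the top, so that [p = 0] also gets a digit. *)
move=> p ->; exists (size p), (fun j : 'I_(size p).+1 => (p`_j)%:~R); split.
  by move=> j; exists p`_j.
rewrite (@horner_coef_wide _ (size p).+1).
  by apply: eq_bigr => j _; rewrite coef_map.
by apply: leq_trans (size_poly _ _) _.
Qed.

End IntegerAdjunction.

Section PrimitiveMinimalPolynomial.
Variables (R : realType) (alpha : R[i]) (M : {poly int}).
Hypothesis M_minpoly : primitive_minpoly M alpha.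

(** By minimality the remainder modulo [M] over the rationals is zero; Gauss's lemma and primitivity
    bring the quotient back to integer coefficients. *)
Lemma primitive_minpoly_dvd (p : {poly int}) :
  root (map_poly intr p) alpha -> exists q, p = M * q.
Proof.
case: M_minpoly => M_prim M_root M_min p_root.
have intr_ratr (q : {poly int}) :
    map_poly ratr (map_poly intr q : {poly rat}) = map_poly intr q :> {poly R[i]}.
  by rewrite -map_poly_comp; apply: eq_map_poly => m /=; rewrite ratr_int.
have M0 : M != 0 by apply: contra_eq_neq M_prim => ->; rewrite zcontents0.
have Mdvd : M %| p.
  rewrite -dvdp_rat_int; apply/negPn/negP => ndvd.
  have := M_min (map_poly intr p %% map_poly intr M) ndvd.
  have -> : root (map_poly ratr
      (map_poly intr p %% map_poly intr M : {poly rat})) alpha.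
    rewrite map_modp !intr_ratr /root.
    have := divp_eq (map_poly intr p : {poly R[i]}) (map_poly intr M).
    move/(congr1 (fun q => q.[alpha])).
    rewrite hornerD hornerM (rootP M_root) (rootP p_root) mulr0 add0r.
    by move=> <-.
  move=> /(_ isT); rewrite leqNgt => /negP; apply.
  have := ltn_modp (map_poly intr p : {poly rat}) (map_poly intr M).
  rewrite size_map_inj_poly ?rmorph0//; last exact: intr_inj.
  by rewrite map_poly_eq0_id0 ?intr_eq0 ?lead_coef_eq0 // => ->.
have [q ->] := dvdpP_int Mdvd.
have := zpolyEprim M.
have : (zcontents M == 1) || (zcontents M == -1).
  by move: M_prim; case: (zcontents M) => [[|[|]]|[|]].
case/orP=> /eqP ->; first by rewrite scale1r => {2}->; exists q.
by rewrite scaleN1r => {2}->; exists (- q); rewrite mulrNN.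
Qed.

(** If [u] is the value of [p] at [alpha], then [M] divides [k - 'X * p]; evaluate at 0. *)
Lemma dvdz_coef0_int_adjoin (k : int) u :
  int_adjoin alpha u -> k%:~R = alpha * u -> (M.[0] %| k)%Z.
Proof.
move=> [p ->] kE.
have /primitive_minpoly_dvd[q /(congr1 (fun r => r.[0]))] :
    root (map_poly intr (k%:P - 'X * p)) alpha.
  rewrite /root rmorphB rmorphM /= map_polyC map_polyX.
  by rewrite hornerD hornerN hornerM hornerC hornerX /= -kE subrr.
rewrite hornerD hornerN !hornerM hornerC hornerX mul0r subr0 => ->.
exact: dvdz_mulr.
Qed.

Lemma primitive_minpoly_coef0 :
  exists2 u, int_adjoin alpha u & (M.[0])%:~R = alpha * u.
Proof.
case: M_minpoly => _ /rootP M_root _.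
(* Write [M] as [M.[0] + 'X * N] and evaluate at [alpha]: the witness is minus the value of [N]. *)
exists (- (map_poly intr (drop_poly 1 M)).[alpha]).
  by apply: int_adjoinN; exists (drop_poly 1 M).
have := M_root; rewrite -{1}(poly_take_drop 1 M) rmorphD rmorphM /=.
rewrite hornerD hornerM map_polyX hornerX.
have -> : take_poly 1 M = (M.[0])%:P.
  by apply/polyP => i; rewrite coef_take_poly coefC horner_coef0; case: i.
rewrite map_polyC hornerC => /eqP; rewrite addr_eq0 => /eqP ->.
by rewrite mulrC mulrN.
Qed.

End PrimitiveMinimalPolynomial.

Section IntegerDigits.
Variables (R : realType) (alpha : R[i]) (M : {poly int}) (S : {fset R[i]}).
Hypothesis M_minpoly : primitive_minpoly M alpha.
Hypothesis S_digits : digit_set alpha S.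
Hypothesis S_int : [set` S] `<=` Zset.
Hypothesis S_card : #|` S|%fset = `|M.[0]|%N.

Local Notation A := (int_adjoin alpha).

Let expansionsS : expansions [set` S] alpha = A.
Proof. by rewrite -expansions_Zset S_digits. Qed.

Lemma first_digit z : A z -> exists u, A u /\ z - alpha * u \in S.
Proof.
rewrite -{1}expansionsS => -[n [f [Sf ->]]].
exists (\sum_(j < n) f (lift ord0 j) * alpha ^+ j); split.
  by apply: int_adjoin_sum => j; apply/S_int/Sf.
rewrite big_ord_recl expr0 mulr1 mulr_sumr.
under [X in _ - X]eq_bigr do rewrite mulrCA -exprS.
by rewrite addrK; apply: Sf.
Qed.

(* The |M(0)| integers 0, ..., |M(0)| - 1 are pairwise incongruent modulo alpha,
   and each of them is congruent to a digit. *)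
Lemma digits_incongruent s t u :
  s \in S -> t \in S -> A u -> s - t = alpha * u -> s = t.
Proof.
pose m := `|M.[0]|%N.
have /choice[f fP] (i : 'I_m) : exists s : S,
    exists2 u, A u & (i%:Z)%:~R = val s + alpha * u.
  have [v [Av Sv]] := first_digit (int_adjoin_int alpha i%:Z).
  by exists [` Sv]%fset, v => //=; rewrite subrK.
have incong (i j : 'I_m) v : A v ->
    (i%:Z)%:~R - (j%:Z)%:~R = alpha * v :> R[i] -> i = j.
  move=> Av; rewrite -rmorphB => /(dvdz_coef0_int_adjoin M_minpoly Av) dvd.
  apply: val_inj => /=; rewrite -(modn_small (ltn_ord i)) -[RHS](modn_small (ltn_ord j)).
  have : (i%:Z == j%:Z %[mod M.[0]])%Z by rewrite eqz_mod_dvd.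
  by rewrite -modz_abs -[X in _ == X]modz_abs !modz_nat eqz_nat => /eqP.
have f_inj : injective f.
  move=> i j fij; have [v Av iE] := fP i; have [w Aw jE] := fP j.
  apply: (incong i j (v - w)); first exact: int_adjoinB.
  by rewrite iE jE fij mulrBr opprD addrACA subrr add0r.
(* By equality of cardinals every digit is the one chosen for some index, so congruent digits come
   from congruent, hence equal, indices. *)
have [g _ gK] : bijective f.
  by apply: inj_card_bij f_inj _; rewrite card_ord -cardfE S_card.
move=> Ss St Au stE.
have [v Av] := fP (g [` Ss]%fset); have [w Aw] := fP (g [` St]%fset).
rewrite !gK /= => tE sE.
suff /(congr1 f) : g [` Ss]%fset = g [` St]%fset by rewrite !gK => /(congr1 val).
apply: (incong _ _ (u + v - w)); first by apply/int_adjoinB/Aw/int_adjoinD.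
by rewrite sE tE mulrBr mulrDr -stE opprD addrACA addrA.
Qed.

Lemma digit_step : exists T : R[i] -> R[i],
  (forall z, A z -> A (T z) /\ z - alpha * T z \in S) /\
  (alpha != 0 -> forall s u, s \in S -> A u -> T (s + alpha * u) = u).
Proof.
have /choice[T TP] z : exists u, A z -> A u /\ z - alpha * u \in S.
  by have [/first_digit[u]|nAz] := pselect (A z); [exists u | exists 0].
exists T; split=> // alpha0 s u Ss Au.
have [|ATz STz] := TP (s + alpha * u).
  by apply/int_adjoinD/int_adjoinMX/Au; have [m _ <-] := S_int Ss; apply: int_adjoin_int.
set v := T _ in ATz STz *; apply: (mulfI alpha0).
have : s + alpha * u - alpha * v = s.
  apply: (@digits_incongruent _ _ (u - v)) => //; first exact: int_adjoinB.
  by ring.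
by rewrite -addrA => /eqP; rewrite -subr_eq0 addrAC subrr add0r subr_eq0 => /eqP.
Qed.

End IntegerDigits.

Theorem theorem2 (R : realType) (alpha : R[i]) (M : {poly int})
    (alpha_alg : algebraicOver (ratr : rat -> R[i]) alpha)
    (M_minpoly : primitive_minpoly M alpha)
    (conj_unimodular : forall beta : R[i], conjugate alpha beta -> `|beta| = 1)
    (min_card : min_digit_card alpha `|M.[0]|%N) :
  forall S : {fset R[i]},
    digit_set alpha S -> #|` S|%fset = `|M.[0]|%N -> ~ ([set` S] `<=` Zset).
Proof.
move=> S S_digits S_card S_int.
have alpha_conj : alpha * alpha^* = 1.
  rewrite -normCK conj_unimodular ?expr1n//.
  by exists M => //; case: M_minpoly.
have alpha0 : alpha != 0.
  by apply: contra_eq_neq alpha_conj => ->; rewrite mul0r eq_sym oner_eq0.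
have M0 : M.[0] != 0.
  (* The element 0 has a first digit, so [S] is nonempty. *)
  have [u [_ Su]] := first_digit S_digits S_int (int_adjoin0 alpha).
  rewrite -absz_gt0 -S_card cardfs_gt0; apply/fset0Pn.
  by exists (0 - alpha * u).
have [T [TP T_uniq]] := digit_step M_minpoly S_digits S_int S_card.
pose A := int_adjoin alpha; pose phi z : R[i] := - (alpha * z)^*.
(* This is where integrality of the digits enters: s is fixed by conjugation. *)
have phi_step s u : s \in S -> phi u = s + alpha * phi (s + alpha * u).
  move=> /S_int[m _ <-]; rewrite /phi !rmorphM rmorphD /= rmorphM rmorph_int.
  have -> (x : R[i]) : alpha * - (alpha^* * x) = - x.
    by rewrite mulrN mulrA alpha_conj mul1r.
  by rewrite opprD addNKr.
pose P z := A z /\ A (phi z).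
have [||||s sP] := @finite_of_injective_absorbed _ T P 0.
- move=> z [Az Aphi]; have [ATz ST] := TP z Az; split=> //.
  rewrite (phi_step _ _ ST) subrK; apply/int_adjoinD/int_adjoinMX/Aphi.
  by have [m _ <-] := S_int _ ST; apply: int_adjoin_int.
- move=> x y [Ax Aphix] [Ay Aphiy] eqT.
  have [_ Sx] := TP x Ax; have [_ Sy] := TP y Ay.
  have := phi_step _ (T y) Sy; rewrite -{1}eqT (phi_step _ (T x) Sx) !subrK.
  (* Comparing the two formulas for [phi (T x) = phi (T y)] shows that the digits of [x] and [y]
     differ by [alpha * (phi y - phi x)]. *)
  move=> phiE; have eqs : x - alpha * T x = y - alpha * T y.
    apply: (digits_incongruent M_minpoly S_digits S_int S_card Sx Sy
              (int_adjoinB Aphiy Aphix)).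
    by rewrite mulrBr -[X in X - _](addrK (alpha * phi x)) phiE; ring.
  by move: eqs; rewrite eqT => /addIr.
- by split; rewrite /phi ?mulr0 ?rmorph0 ?oppr0; apply: int_adjoin0.
- move=> z [Az _]; move: Az; rewrite /A -expansions_Zset S_digits => -[n [f [Sf ->]]].
  (* Each application of [T] strips the lowest digit; the induction starts from the empty sum, which
     is 0. *)
  exists n; elim: n.+1 f Sf => {n} [|n IHn] f Sf; first by rewrite big_ord0.
  rewrite big_ord_recl expr0 mulr1 iterSr.
  under eq_bigr do rewrite exprS mulrCA.
  rewrite -mulr_sumr T_uniq//; first exact: IHn.
    exact: Sf.
  by apply: int_adjoin_sum => j; apply/S_int/Sf.
have [u Au uE] := primitive_minpoly_coef0 M_minpoly.
pose v (k : nat) : R[i] := k%:R * u.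
have v_inj : injective v.
  move=> j k; apply: contra_eq => neq_jk.
  have u0 : u != 0.
    by apply: contra_neq M0 => u0; apply/eqP; rewrite -(intr_eq0 R[i]) uE u0 mulr0.
  by rewrite (inj_eq (mulIf u0)) eqr_nat.
have vP k : P (v k).
  have vA : A (v k) by apply: int_adjoinM => //; apply: (int_adjoin_int _ k%:Z).
  (* Here [alpha * v k] is the integer [k * M.[0]], fixed by conjugation. *)
  split=> //; apply: int_adjoinN.
  rewrite /v mulrCA -uE rmorphM rmorph_nat rmorph_int.
  by apply: int_adjoinM; [exact: (int_adjoin_int _ k%:Z) | exact: int_adjoin_int].
have /uniq_leq_size : uniq [seq v k | k <- iota 0 (size s).+1].
  by rewrite map_inj_uniq ?iota_uniq.
move=> /(_ s); rewrite size_map size_iota ltnn => leF; apply/notF/leF.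
by move=> _ /mapP[k _ ->]; apply: sP.
Qed.
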